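(* Let $Y$ be a (lower) semilattice, $\{X_\alpha \mid \alpha\in Y\}$ a family of disjoint sets indexed by $Y$, and $r_\alpha: X_\alpha\times X_\alpha\to X_\alpha\times X_\alpha$ a set-theoretic solution of the Yang-Baxter equation on $X_\alpha$, for every $\alpha\in Y$. For each pair $\alpha,\beta$ of elements of $Y$ such that $\alpha\geq\beta$, let $\phi_{\alpha,\beta}:X_\alpha\to X_\beta$ be a map. Suppose that the following conditions are satisfied: 1. $\phi_{\alpha,\alpha}$ is the identity map of $X_\alpha$, for every $\alpha\in Y$; 2. $\phi_{\beta,\gamma}\phi_{\alpha,\beta}=\phi_{\alpha,\gamma}$, for all $\alpha,\beta,\gamma\in Y$ such that $\alpha\geq\beta\geq\gamma$; 3. $(\phi_{\alpha,\beta}\times\phi_{\alpha,\beta})\,r_\alpha=r_\beta\,(\phi_{\alpha,\beta}\times\phi_{\alpha,\beta})$, for all $\alpha,\beta\in Y$ such that $\alpha\geq\beta$. Set $X=\bigcup\{X_\alpha\mid\alpha\in Y\}$. Then the map $r:X\times X\to X\times X$ defined by $$r(x,y):=r_{\alpha\beta}\big(\phi_{\alpha,\alpha\beta}(x),\phi_{\beta,\alpha\beta}(y)\big),$$ for all $x\in X_\alpha$ and $y\in X_\beta$ (and all $\alpha,\beta\in Y$), is a set-theoretic solution of the Yang-Baxter equation on $X$.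
   Context: A (lower) semilattice $Y$ is a commutative semigroup, written multiplicatively, in which every element is idempotent, with partial order $\alpha\geq\beta$ if and only if $\alpha\beta=\beta$; thus $\alpha\beta$ is the meet of $\alpha$ and $\beta$. A set-theoretic solution of the Yang-Baxter equation (briefly, a solution) on a set $X$ is a map $r:X\times X\to X\times X$ (not necessarily bijective) such that, on $X^3$, $$(r\times\mathrm{id}_X)(\mathrm{id}_X\times r)(r\times\mathrm{id}_X)=(\mathrm{id}_X\times r)(r\times\mathrm{id}_X)(\mathrm{id}_X\times r).$$ Juxtaposition of maps denotes composition, with the rightmost map applied first. *)

(* Defs.v *)
From mathcomp Require Import all_boot.

Set Implicit Arguments.
Unset Strict Implicit.
Unset Printing Implicit Defensive.

Definition prod_map (A B C D : Type) (f : A -> C) (g : B -> D)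
    (p : A * B) : C * D := (f p.1, g p.2).

Section YangBaxter.
Variables (X : Type) (r : X * X -> X * X).

(* [X * X * X] is [(X * X) * X]. *)
Definition r_times_id : X * X * X -> X * X * X := prod_map r id.

(* [id x r], conjugated by the reassociation [(X * X) * X ~ X * (X * X)]. *)
Definition id_times_r (t : X * X * X) : X * X * X :=
  let: (x, y, z) := t in
  let: (x', (y', z')) := prod_map id r (x, (y, z)) in (x', y', z').

Definition YB_solution : Prop :=
  r_times_id \o id_times_r \o r_times_id
    =1 id_times_r \o r_times_id \o id_times_r.
End YangBaxter.

(* A semilattice is an arbitrary type [Y] (decidable equality is not required)
   with an associative and commutative law [mul : SemiGroup.com_law Y]
   satisfying [idempotent_op mul]. *)
Section Semilattice.
Variables (Y : Type) (mul : SemiGroup.com_law Y).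

Definition sl_ge (a b : Y) : Prop := mul a b = b.

Hypothesis mul_idem : idempotent_op mul.

Lemma sl_ge_mull (a b : Y) : sl_ge a (mul a b).
Proof. by rewrite /sl_ge (SemiGroup.opA a a b) -[in RHS](mul_idem a). Qed.

Lemma sl_ge_mulr (a b : Y) : sl_ge b (mul a b).
Proof. by rewrite /sl_ge (SemiGroup.opC a b); apply: sl_ge_mull. Qed.

(* The union of the disjoint sets [X a] is the type [{a : Y & X a}]; the
   elements of [X a] are those with first component [a].

   The maps [phi] take a proof of [a >= b] as an argument. They do not depend
   on the choice of that proof as soon as [phi a a h] is the identity for every
   [h] and [phi b c hbc \o phi a b hab =1 phi a c hac] for all proofs
   (take [c := b]), so no proof irrelevance is needed. *)
Definition strong_semilattice_map (X : Y -> Type)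
    (r : forall a : Y, X a * X a -> X a * X a)
    (phi : forall a b : Y, sl_ge a b -> X a -> X b)
    (p : {a : Y & X a} * {a : Y & X a}) : {a : Y & X a} * {a : Y & X a} :=
  let: (existT a x, existT b y) := p in
  let: (u, v) := r (mul a b) (phi a (mul a b) (sl_ge_mull a b) x,
                              phi b (mul a b) (sl_ge_mulr a b) y) in
  (existT X (mul a b) u, existT X (mul a b) v).
End Semilattice.

(* Main.v *)
Require Import Defs.
From mathcomp Require Import all_boot.

(** The idea is that the braid relation on a triple with components in [X a],
    [X b], [X c] can be tested inside the single set [X d], [d = a b c], where
    it holds because [r d] is a solution.

    Two facts make this work. First, the maps [phi _ d] intertwine the glued map
    with [r d] on all components lying above [d] ([lies_over_map]): by
    functoriality of [phi], restricting to the meet and then to [d] is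
    restricting to [d], and [phi] commutes with the solutions. Hence both sides
    of the braid relation restrict to the two sides of the braid relation for
    [r d] at the restricted triple ([related_r_times_id],
    [related_id_times_r]), which agree. Second, after all three applications
    every component already has index [d], because it has met all of [a], [b]
    and [c] ([tags_braid]); on [X d] the restriction is the identity, so equal restrictions
    mean equal elements ([lies_over_eq]).

    The indices of the components of the two sides, such as [(ab)((ab)c)] and
    [a(bc)], are equal but not convertible. Restriction is therefore handled as
    a relation between points of the union and points of [X d], which
    needs no transport along equalities of indices. *)

Section Related.
Variables (S T : Type) (P : S -> T -> Prop).
Variables (R : S * S -> S * S) (R' : T * T -> T * T).

Definition related3 (t : S * S * S) (t' : T * T * T) : Prop :=
  [/\ P t.1.1 t'.1.1, P t.1.2 t'.1.2 & P t.2 t'.2].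

Hypothesis PR : forall p q u v, P p u -> P q v ->
  P (R (p, q)).1 (R' (u, v)).1 /\ P (R (p, q)).2 (R' (u, v)).2.

Lemma related_r_times_id t t' :
  related3 t t' -> related3 (r_times_id R t) (r_times_id R' t').
Proof.
case: t t' => [[p q] w] [[u v] z] [/= Ppu Pqv Pwz].
by have [? ?] := PR _ _ _ _ Ppu Pqv.
Qed.

Lemma related_id_times_r t t' :
  related3 t t' -> related3 (id_times_r R t) (id_times_r R' t').
Proof.
case: t t' => [[p q] w] [[u v] z] [/= Ppu Pqv Pwz].
have := PR _ _ _ _ Pqv Pwz; rewrite /id_times_r /prod_map /=.
by case: (R _) (R' _) => [? ?] [? ?] [? ?].
Qed.

End Related.

Arguments related3 {S T}.

Lemma related3_eq (S : Type) (s t : S * S * S) : related3 eq s t -> s = t.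
Proof. by case: s t => [[? ?] ?] [[? ?] ?] [/= -> -> ->]. Qed.

(** Associativity restated for the commutative law itself: the projection in
   [SemiGroup.opA] passes through the underlying non-commutative structure and
   blocks syntactic rewriting. *)
Lemma meetA (Y : Type) (mul : SemiGroup.com_law Y) : associative mul.
Proof. exact: SemiGroup.opA. Qed.

Lemma sl_ge_meet (Y : Type) (mul : SemiGroup.com_law Y) (a b d : Y) :
  sl_ge mul a d -> sl_ge mul b d -> sl_ge mul (mul a b) d.
Proof. by rewrite /sl_ge => had hbd; rewrite -meetA hbd. Qed.

Section StrongSemilattice.
Variables (Y : Type) (mul : SemiGroup.com_law Y).
Hypothesis mul_idem : idempotent_op mul.
Variables (X : Y -> Type) (r : forall a : Y, X a * X a -> X a * X a).
Variable phi : forall a b : Y, sl_ge mul a b -> X a -> X b.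

Let R := strong_semilattice_map mul_idem r phi.

Lemma tag_strong_semilattice_map p q :
  tag (R (p, q)).1 = mul (tag p) (tag q) /\
  tag (R (p, q)).2 = mul (tag p) (tag q).
Proof. by case: p q => [a x] [b y]; rewrite /R /=; case: (r _). Qed.

(** Quantifying over the proof of [tag p >= d] lets statements about
    restrictions avoid naming the order proofs built up by the iterated
    products. *)
Definition lies_over d (p : {a : Y & X a}) (u : X d) : Prop :=
  exists h : sl_ge mul (tag p) d, phi (tag p) d h (tagged p) = u.

Section Identity.
Hypothesis phi_id : forall a (haa : sl_ge mul a a), phi a a haa =1 id.

Lemma lies_over_eq d p (u : X d) :
  lies_over d p u -> tag p = d -> p = existT X d u.
Proof.
case: p => a x [/= h <-] {u} ad; case: d / ad h => h.
by rewrite phi_id.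
Qed.

Lemma lies_over_inj d p q (u : X d) :
  lies_over d p u -> lies_over d q u -> tag p = d -> tag q = d -> p = q.
Proof.
by move=> pu qu tp tq; rewrite (lies_over_eq _ _ _ pu tp) (lies_over_eq _ _ _ qu tq).
Qed.

End Identity.

Section Naturality.
Hypothesis phi_comp : forall a b c (hab : sl_ge mul a b) (hbc : sl_ge mul b c)
  (hac : sl_ge mul a c), phi b c hbc \o phi a b hab =1 phi a c hac.
Hypothesis phi_r : forall a b (hab : sl_ge mul a b),
  prod_map (phi a b hab) (phi a b hab) \o r a
    =1 r b \o prod_map (phi a b hab) (phi a b hab).

(** Since [d] is below both indices it is below their meet, so restriction to
    [d] factors through the set where the glued map is computed. *)
Lemma lies_over_map d p q (u v : X d) :
    lies_over d p u -> lies_over d q v ->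
  lies_over d (R (p, q)).1 (r d (u, v)).1 /\
  lies_over d (R (p, q)).2 (r d (u, v)).2.
Proof.
case: p q => [a x] [b y] [/= had <-] [/= hbd <-].
have habd := sl_ge_meet _ _ _ _ _ had hbd.
rewrite /R /strong_semilattice_map.
have := phi_r _ _ habd (phi a (mul a b) (sl_ge_mull mul_idem a b) x,
                        phi b (mul a b) (sl_ge_mulr mul_idem a b) y).
rewrite /= /prod_map /=.
have /= -> := phi_comp _ _ _ (sl_ge_mull mul_idem a b) habd had x.
have /= -> := phi_comp _ _ _ (sl_ge_mulr mul_idem a b) habd hbd y.
by case: (r (mul a b) _) => [s t] <- /=; split; exists habd.
Qed.

End Naturality.
End StrongSemilattice.

(** Taking indices intertwines [R] with [(a, b) |-> (ab, ab)], and both braid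
    words in the latter map send [(a, b, c)] to [(abc, abc, abc)]: each word
    brings every index into contact with the other two. *)
Lemma tags_braid (Y : Type) (mul : SemiGroup.com_law Y)
    (mul_idem : idempotent_op mul) (X : Y -> Type)
    (R : {a : Y & X a} * {a : Y & X a} -> {a : Y & X a} * {a : Y & X a})
    (tagR : forall p q, tag (R (p, q)).1 = mul (tag p) (tag q) /\
                        tag (R (p, q)).2 = mul (tag p) (tag q))
    (p q w : {a : Y & X a}) (d := mul (mul (tag p) (tag q)) (tag w)) :
  related3 (fun s e => tag s = e)
    ((r_times_id R \o id_times_r R \o r_times_id R) (p, q, w)) (d, d, d) /\
  related3 (fun s e => tag s = e)
    ((id_times_r R \o r_times_id R \o id_times_r R) (p, q, w)) (d, d, d).
Proof.
(* The lifting lemmas apply to the relation [tag s = e] just as they do to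
   restriction, so the indices are computed by [M] alone. *)
pose M (e : Y * Y) := (mul e.1 e.2, mul e.1 e.2).
have tagM s t e f : tag s = e -> tag t = f ->
    tag (R (s, t)).1 = (M (e, f)).1 /\ tag (R (s, t)).2 = (M (e, f)).2.
  by move=> <- <-; apply: tagR.
have t0 : related3 (fun s e => tag s = e) (p, q, w)
    (tag p, tag q, tag w) by [].
have r1 := related_r_times_id _ _ _ R M tagM.
have r2 := related_id_times_r _ _ _ R M tagM.
have := r1 _ _ (r2 _ _ (r1 _ _ t0)); have := r2 _ _ (r1 _ _ (r2 _ _ t0)).
rewrite /r_times_id /id_times_r /prod_map /M /= -/d.
have -> : mul (mul (tag p) (tag q)) d = d by apply: sl_ge_mull.
rewrite meetA -/d.
have -> : mul d (mul (tag q) (tag w)) = d.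
  by rewrite SemiGroup.opC /d -[mul (mul (tag p) _) _]meetA; apply: sl_ge_mulr.
by split.
Qed.

Theorem theorem12
  (Y : Type) (mul : SemiGroup.com_law Y) (mul_idem : idempotent_op mul)
  (X : Y -> Type)
  (r : forall a : Y, X a * X a -> X a * X a)
  (r_sol : forall a : Y, YB_solution (r a))
  (phi : forall a b : Y, sl_ge mul a b -> X a -> X b)
  (phi_id : forall (a : Y) (haa : sl_ge mul a a), phi a a haa =1 id)
  (phi_comp : forall (a b c : Y) (hab : sl_ge mul a b) (hbc : sl_ge mul b c)
     (hac : sl_ge mul a c), phi b c hbc \o phi a b hab =1 phi a c hac)
  (phi_r : forall (a b : Y) (hab : sl_ge mul a b),
     prod_map (phi a b hab) (phi a b hab) \o r a
       =1 r b \o prod_map (phi a b hab) (phi a b hab)) :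
  YB_solution (strong_semilattice_map mul_idem r phi).
Proof.
case=> [[p q] w]; set R := strong_semilattice_map _ _ _.
have [tagL tagR] := tags_braid _ _ mul_idem _ R
  (tag_strong_semilattice_map _ _ mul_idem _ r phi) p q w.
move: tagL tagR; set d := mul (mul _ _) _ => tagL tagR.
have hpq : sl_ge mul (mul (tag p) (tag q)) d by apply: sl_ge_mull.
have hp : sl_ge mul (tag p) d.
  by rewrite /d -meetA; apply: sl_ge_mull.
have hq : sl_ge mul (tag q) d.
  rewrite /d [mul (tag p) _]SemiGroup.opC -meetA.
  exact: sl_ge_mull.
have hw : sl_ge mul (tag w) d by apply: sl_ge_mulr.
pose t := (phi _ d hp (tagged p), phi _ d hq (tagged q), phi _ d hw (tagged w)).
have t0 : related3 (lies_over _ mul _ phi d) (p, q, w) t.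
  by split; [exists hp | exists hq | exists hw].
have over := lies_over_map _ _ mul_idem _ r phi phi_comp phi_r d.
have r1 := related_r_times_id _ _ _ R (r d) over.
have r2 := related_id_times_r _ _ _ R (r d) over.
have overL := r1 _ _ (r2 _ _ (r1 _ _ t0)).
have overR := r2 _ _ (r1 _ _ (r2 _ _ t0)).
have /= sol := r_sol d t; rewrite {}sol in overL.
case: overL overR tagL tagR => [L1 L2 L3] [R1 R2 R3] [T1 T2 T3] [U1 U2 U3].
have inj := lies_over_inj _ _ _ phi phi_id d.
apply: related3_eq; split.
- exact: inj _ _ _ L1 R1 T1 U1.
- exact: inj _ _ _ L2 R2 T2 U2.
- exact: inj _ _ _ L3 R3 T3 U3.
Qed.
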